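(* Let $K$ be a number field of degree $n$ over $\mathbb{Q}$ and let $\Delta(u_1,\dots,u_n)$ be the primitive form whose square is the discriminant of the fundamental equation of $K$ freed from its numerical factor. Let $\Gamma$ be a number field with ring of integers $\mathcal{O}_\Gamma$, $p$ a rational prime, $\mathfrak{p}$ a prime ideal of $\mathcal{O}_\Gamma$ dividing $p$, and $k$ the residual degree of $\mathfrak{p}$. Then $\mathfrak{p}$ is, in the rationality domain $\Gamma$, a common inessential divisor of all equation discriminants of $K$ if and only if $\Delta(u_1,\dots,u_n)$ contains the divisor system $$P_k=(p;\,u_1^{p^k}-u_1,\dots,u_n^{p^k}-u_n).$$
   Context: Let $\xi_1,\dots,\xi_n$ be an integral basis of the ring of integers of $K$, $u_1,\dots,u_n$ indeterminates, $w_0=u_1\xi_1+\cdots+u_n\xi_n$ the fundamental form and $w_0,\dots,w_{n-1}$ its conjugates (replace the $\xi_i$ by their conjugates under the $n$ embeddings of $K$). The discriminant of the fundamental equation $\prod_j(w-w_j)=0$ is $\Delta(u_1,\dots,u_n)^2\cdot D$, where $D$ is the discriminant of $K$ (the numerical factor) and $\Delta$ is a homogeneous polynomial of degree $\frac{n(n-1)}2$ with integer coefficients having no common divisor (defined up to sign). The prime ideal $\mathfrak{p}$ of $\Gamma$ is a common inessential divisor in the rationality domain $\Gamma$ of all equation discriminants of $K$ if $\Delta(a_1,\dots,a_n)\in\mathfrak{p}$ for all $a_1,\dots,a_n\in\mathcal{O}_\Gamma$ (i.e. the indeterminates $u_i$ take values that are arbitrary algebraic integers of $\Gamma$ rather than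 rational integers). A polynomial in $\mathbb{Z}[u_1,\dots,u_n]$ contains the divisor system $P_k$ (in Kronecker's sense) if it lies in the ideal of $\mathbb{Z}[u_1,\dots,u_n]$ generated by $p,\,u_1^{p^k}-u_1,\dots,u_n^{p^k}-u_n$. *)

(* Defs.v *)
From HB Require Import structures.
From mathcomp Require Import all_boot all_order all_algebra all_field.
From mathcomp Require Import boolp.
From mathcomp Require Import mpoly.

Set Implicit Arguments.
Unset Strict Implicit.
Unset Printing Implicit Defensive.

Import GRing.Theory Num.Theory.

Local Open Scope ring_scope.

(* A number field is a K : fieldExtType rat.  Membership in its ring of       *)
(* integers is the library's integralOver along int -> K; asbool only turns   *)
(* this Prop into the boolean predicate required of a subtype.                *)
Definition integers (K : fieldExtType rat) : {pred K} :=
  fun x => `[< integralOver (intr : int -> K) x >].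
Arguments integers : clear implicits.

Fact integers_subring_closed (K : fieldExtType rat) :
  subring_closed (integers K).
Proof.
split.
- exact/asboolP/integral1.
- by move=> x y /asboolP ix /asboolP iy; apply/asboolP/integral_sub.
- by move=> x y /asboolP ix /asboolP iy; apply/asboolP/integral_mul.
Qed.

HB.instance Definition _ (K : fieldExtType rat) :=
  GRing.isSubringClosed.Build K (integers K) (@integers_subring_closed K).

Record ringOfIntegers (K : fieldExtType rat) : Type := RingOfIntegers {
  integer_val : K;
  integer_valP : integer_val \in integers K
}.

HB.instance Definition _ (K : fieldExtType rat) :=
  [isSub for @integer_val K].
HB.instance Definition _ (K : fieldExtType rat) :=
  [Choice of ringOfIntegers K by <:].
HB.instance Definition _ (K : fieldExtType rat) :=
  [SubChoice_isSubComNzRing of ringOfIntegers K by <:].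

Definition is_integral_basis (K : fieldExtType rat) (n : nat)
    (xi : 'I_n -> ringOfIntegers K) : Prop :=
  forall x : ringOfIntegers K,
    exists! c : {ffun 'I_n -> int}, x = \sum_(i < n) xi i *~ c i.

(* The conjugates are taken in algC: every embedding of a number field in the *)
(* complex numbers lands there.  The indexing of the embeddings by 'I_n is a  *)
(* bijection, up to extensional equality of morphisms.                        *)
Definition enumerates_embeddings (K : fieldExtType rat) (n : nat)
    (sigma : 'I_n -> {rmorphism K -> algC}) : Prop :=
  forall f : {rmorphism K -> algC}, exists! j : 'I_n, f =1 sigma j.

Definition conjugate_form (K : fieldExtType rat) (n : nat)
    (sigma : 'I_n -> {rmorphism K -> algC}) (xi : 'I_n -> ringOfIntegers K)
    (j : 'I_n) : {mpoly algC[n]} :=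
  \sum_(i < n) sigma j (integer_val (xi i)) *: 'X_i.

(* Discriminant of the fundamental equation \prod_j (w - w_j) = 0, which is   *)
(* monic in w, as the product of the squared differences of its roots.        *)
Definition fundamental_discriminant (K : fieldExtType rat) (n : nat)
    (sigma : 'I_n -> {rmorphism K -> algC}) (xi : 'I_n -> ringOfIntegers K) :
    {mpoly algC[n]} :=
  \prod_(i < n) \prod_(j < n | (i < j)%N)
    (conjugate_form sigma xi i - conjugate_form sigma xi j) ^+ 2.

Definition field_discriminant (K : fieldExtType rat) (n : nat)
    (sigma : 'I_n -> {rmorphism K -> algC}) (xi : 'I_n -> ringOfIntegers K) :
    algC :=
  (\det (\matrix_(i < n, j < n) sigma i (integer_val (xi j)))) ^+ 2.

Definition primitive_mpoly (n : nat) (f : {mpoly int[n]}) : Prop :=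
  forall d : int, (forall m : 'X_{1..n}, (d %| f@_m)%Z) -> `|d| = 1.

(* A relation rather than a function, as Delta is only defined up to sign.    *)
Definition is_discriminant_form (K : fieldExtType rat) (n : nat)
    (sigma : 'I_n -> {rmorphism K -> algC}) (xi : 'I_n -> ringOfIntegers K)
    (Delta : {mpoly int[n]}) : Prop :=
  [/\ Delta \is 'C(n, 2).-homog,
      primitive_mpoly Delta
    & fundamental_discriminant sigma xi =
      field_discriminant sigma xi *: map_mpoly intr Delta ^+ 2].

(* k is the dimension over 'F_p of the residue ring modulo P: the latter has  *)
(* characteristic p, pPrimeCharType is its 'F_p-algebra structure, and e is a *)
(* basis with k elements.                                                     *)
Definition is_residual_degree (Gamma : fieldExtType rat) (p : nat)
    (P : prime_idealr (ringOfIntegers Gamma)) (k : nat) : Prop :=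
  exists (pcharP : p \in [pchar {ideal_quot P}])
         (e : 'I_k -> pPrimeCharType pcharP),
    forall y : pPrimeCharType pcharP,
      exists! c : {ffun 'I_k -> 'F_p}, y = \sum_(i < k) c i *: e i.

Definition common_inessential_divisor (n : nat) (Delta : {mpoly int[n]})
    (Gamma : fieldExtType rat) (P : prime_idealr (ringOfIntegers Gamma)) :
    Prop :=
  forall a : 'I_n -> ringOfIntegers Gamma,
    (map_mpoly intr Delta).@[a] \in (P : {pred ringOfIntegers Gamma}).

Definition contains_divisor_system (n p k : nat) (f : {mpoly int[n]}) : Prop :=
  exists (g : {mpoly int[n]}) (h : 'I_n -> {mpoly int[n]}),
    f = g * p%:R + \sum_(i < n) h i * ('X_i ^+ (p ^ k) - 'X_i).

(* Main.v *)
Require Import Defs.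
From mathcomp Require Import all_boot all_order all_algebra all_field.
From mathcomp Require Import boolp mpoly zify.
From mathcomp Require Import ring_quotient.

Import GRing.Theory Num.Theory.

Local Open Scope ring_scope.

(** Both sides say that the reduction of [f], the form [Delta], is zero as a
    function on a finite residue ring.  The residue ring [R] of [P] is an
    integral domain of characteristic [p] with exactly [q = p ^ k] elements,
    and [P] contains every value of [f] exactly when the reduction of [f]
    vanishes on all of [R ^ n].

    Since [y ^+ q = y] for every [y] in [R] ([expf_card_domain]), a polynomial
    in the ideal generated by [p] and the ['X_i ^+ q - 'X_i] vanishes there.
    Conversely, modulo the ['X_i ^+ q - 'X_i] alone, [f] is congruent to a
    polynomial [r] all of whose exponents are below [q]
    ([mpoly_reduce_exponents]).  If [f] vanishes on [R ^ n], so does [r], and a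
    polynomial with exponents below [q] that vanishes at [q ^ n] grid points is
    zero over [R] ([mpoly_vanishing_eq0]).  As [R] has characteristic [p], all
    integer coefficients of [r] are then divisible by [p], which puts [f] in
    the ideal. *)

(** * Finite integral domains *)

Lemma mulf_domain_neq0 {R : comNzRingType}
    (R_domain : forall x y : R, x * y = 0 -> (x == 0) || (y == 0)) (x y : R) :
  x != 0 -> y != 0 -> x * y != 0.
Proof.
by move=> x0 y0; apply/negP => /eqP/R_domain; rewrite (negPf x0) (negPf y0).
Qed.

Lemma prodf_domain_neq0 {R : comNzRingType}
    (R_domain : forall x y : R, x * y = 0 -> (x == 0) || (y == 0))
    (I : finType) (A : {pred I}) (F : I -> R) :
  (forall i, A i -> F i != 0) -> \prod_(i | A i) F i != 0.
Proof.
move=> F0; apply: (@big_ind R (fun x => x != 0)) => //; first exact: oner_neq0.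
exact: mulf_domain_neq0.
Qed.

(** Multiplication by [y != 0] permutes the nonzero elements, so it leaves
    their product unchanged; cancelling that product gives [y ^+ q.-1 = 1].
    The domain is given by its zero-divisor axiom and an enumeration [v], which
    is the form in which the quotient by a prime ideal is known here. *)
Lemma expf_card_domain {R : comNzRingType}
    (R_domain : forall x y : R, x * y = 0 -> (x == 0) || (y == 0))
    {q : nat} {v : 'I_q -> R} (v_bij : bijective v) (y : R) :
  y ^+ q = y.
Proof.
have [w vK wK] := v_bij.
have q_gt0 : (0 < q)%N by case: (w 0) => i /(leq_ltn_trans (leq0n i)).
have [-> | y0] := eqVneq y 0; first by rewrite expr0n eqn0Ngt q_gt0.
have y_reg (x : R) : y * x = 0 -> x = 0.
  by move/R_domain; rewrite (negPf y0) => /eqP.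
pose s i := w (y * v i).
have s_inj : injective s.
  move=> i j /(congr1 v); rewrite !wK => /eqP; rewrite -subr_eq0 -mulrBr.
  by move/eqP/y_reg/eqP; rewrite subr_eq0 => /eqP/(bij_inj v_bij).
pose Pi := \prod_(i | v i != 0) v i.
have Pi0 : Pi != 0 by apply: prodf_domain_neq0.
have nz_card : #|[pred i | v i != 0]| = q.-1.
  rewrite -[q in RHS]card_ord [in RHS](cardD1 (w 0)) inE add1n /=.
  by apply: eq_card => i; rewrite !inE andbT -(inj_eq (bij_inj v_bij)) wK.
have : y ^+ q.-1 * Pi = Pi.
  rewrite -nz_card -prodr_const -big_split /= [RHS](reindex_inj s_inj) /=.
  apply: eq_big => [i|i _]; last by rewrite wK.
  rewrite wK; apply/idP/idP => [|vi0]; last first.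
    by apply: contraNneq vi0 => ->; rewrite mulr0.
  exact: mulf_domain_neq0.
move/eqP; rewrite -subr_eq0 -{2}[Pi]mul1r -mulrBl => /eqP/R_domain.
rewrite (negPf Pi0) orbF subr_eq0 => /eqP yq1.
by rewrite -(prednK q_gt0) exprS yq1 mulr1.
Qed.

(** * Polynomials with bounded exponents *)

(** The Vandermonde matrix of the values of [v] times its adjugate is scalar,
    so column [l] of the adjugate is a functional on the functions of one
    variable that sends [x ^+ e], for [e < q], to the determinant if [e = l]
    and to 0 otherwise.  The product of [n] such functionals, applied to the
    values of [f] on the grid, isolates one coefficient of [f] up to the factor
    [\det V ^+ n], which is nonzero because the values of [v] are distinct. *)
Lemma mpoly_vanishing_eq0 {R : comNzRingType}
    (R_domain : forall x y : R, x * y = 0 -> (x == 0) || (y == 0))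
    {q : nat} {v : 'I_q -> R} (v_inj : injective v)
    {n : nat} (f : {mpoly R[n]}) :
  (forall (m : 'X_{1..n}) i, (q <= m i)%N -> f@_m = 0) ->
  (forall b : {ffun 'I_n -> 'I_q}, f.@[fun i => v (b i)] = 0) ->
  f = 0.
Proof.
move=> f_red f_van.
pose V := Vandermonde q (\row_j v j).
have detV0 : \det V != 0.
  rewrite det_Vandermonde; apply: prodf_domain_neq0 => // i _.
  apply: prodf_domain_neq0 => // j lt_ij.
  rewrite !mxE subr_eq0 (inj_eq v_inj).
  by apply: contraTneq lt_ij => ->; rewrite ltnn.
have dual (e l : 'I_q) : \sum_j v j ^+ e * (\adj V) j l = \det V *+ (e == l).
  have /matrixP/(_ e l) := mul_mx_adj V; rewrite !mxE => <-.
  by apply: eq_bigr => j _; rewrite !mxE.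
have supp_red (m : 'X_{1..n}) i : f@_m != 0 -> (m i < q)%N.
  by rewrite ltnNge; apply: contra => /f_red ->.
apply/mpolyP => m0; rewrite mcoeff0; have [//|fm0] := eqVneq f@_m0 0.
pose l i := Ordinal (supp_red m0 i fm0).
(* Exchange the sum over the grid with the sum over the monomials of f; each
   monomial then contributes a product of n one-variable sums. *)
have pick : \sum_(b : {ffun 'I_n -> 'I_q})
    f.@[fun i => v (b i)] * \prod_i (\adj V) (b i) (l i) = f@_m0 * \det V ^+ n.
  transitivity (\sum_(m <- msupp f) f@_m *
      \prod_i \sum_j v j ^+ m i * (\adj V) j (l i)).
    under eq_bigr do rewrite mevalE mulr_suml.
    rewrite exchange_big /=; apply: eq_bigr => m _.
    rewrite bigA_distr_bigA mulr_sumr; apply: eq_bigr => b _.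
    by rewrite -mulrA big_split.
  transitivity (\sum_(m <- msupp f) (f@_m * \det V ^+ n) *+ (m == m0)).
    apply: eq_big_seq => m; rewrite mcoeff_msupp => fm.
    under eq_bigr => i _ do
      rewrite (dual (Ordinal (supp_red m i fm)) (l i)) -val_eqE /=.
    have [->|ne_m] := eqVneq m m0.
      under eq_bigr => i _ do rewrite eqxx mulr1n.
      by rewrite prodr_const card_ord.
    have [i ne_i] : exists i, m i != m0 i.
      apply/existsP; apply: contraR ne_m => /existsPn eq_m.
      by apply/eqP/mnmP => i; apply/eqP; rewrite -[_ == _]negbK eq_m.
    by rewrite (bigD1 i) //= (negPf ne_i) mulr0n mul0r mulr0.
  rewrite (bigD1_seq m0) ?mcoeff_msupp ?msupp_uniq //= eqxx big1 ?addr0 // => m.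
  by move/negPf ->.
have detVn0 : \det V ^+ n != 0.
  by rewrite -[n]card_ord -prodr_const; apply: prodf_domain_neq0.
have /R_domain : f@_m0 * \det V ^+ n = 0.
  by rewrite -pick big1 // => b _; rewrite f_van mul0r.
by rewrite (negPf detVn0) orbF => /eqP.
Qed.

(** As long as some exponent of a monomial is at least [q], replacing the
    factor ['X_i ^+ q] by ['X_i] changes it by a multiple of
    ['X_i ^+ q - 'X_i] and lowers the total degree, because [1 < q]. *)
Lemma mpoly_reduce_exponents {S : comNzRingType} {n q : nat} (q_gt1 : (1 < q)%N)
    (f : {mpoly S[n]}) :
  exists (r : {mpoly S[n]}) (h : 'I_n -> {mpoly S[n]}),
    (forall (m : 'X_{1..n}) i, (q <= m i)%N -> r@_m = 0) /\
    f = r + \sum_(i < n) h i * ('X_i ^+ q - 'X_i).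
Proof.
have monom d (m : 'X_{1..n}) : (mdeg m < d)%N ->
    exists (m' : 'X_{1..n}) (h : 'I_n -> {mpoly S[n]}),
    (forall i, m' i < q)%N /\
    'X_[m] = 'X_[m'] + \sum_(i < n) h i * ('X_i ^+ q - 'X_i).
  elim: d m => // d IHd m deg_m.
  have [/existsP[i le_q]|/existsPn m_red] :=
    boolP [exists i, (q <= m i)%N]; last first.
    exists m, (fun=> 0); split=> [i|]; first by rewrite ltnNge.
    by rewrite big1 ?addr0 // => i _; rewrite mul0r.
  have [m1 mE] : exists m1, m = (m1 + U_(i) *+ q)%MM.
    exists (m - U_(i) *+ q)%MM; rewrite submK //; apply/mnm_lepP => j.
    by rewrite mulmnE mnm1E; case: eqP => [<-|_]; rewrite ?mul1n.
  have [|m' [h [m'_red hE]]] := IHd (m1 + U_(i))%MM.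
    by move: deg_m; rewrite mE !mdegD mdegMn mdeg1; lia.
  exists m', (fun j => h j + (if j == i then 'X_[m1] else 0)); split=> //.
  under eq_bigr do rewrite mulrDl.
  rewrite big_split /= addrA -hE (bigD1 i) //= eqxx.
  rewrite [X in _ + (_ + X)]big1; last first.
    by move=> j /negPf ->; rewrite mul0r.
  by rewrite addr0 mulrBr mE !mpolyXD mpolyXn addrC subrK.
pose reducible f0 := exists (r : {mpoly S[n]}) (h : 'I_n -> {mpoly S[n]}),
  (forall (m : 'X_{1..n}) i, (q <= m i)%N -> r@_m = 0) /\
  f0 = r + \sum_(i < n) h i * ('X_i ^+ q - 'X_i).
rewrite -/(reducible f) [f]mpolyE; apply: (big_ind reducible).
- exists 0, (fun=> 0); split=> [m i _|]; first by rewrite mcoeff0.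
  by rewrite big1 ?addr0 // => i _; rewrite mul0r.
- move=> _ _ [r1 [h1 [red1 ->]]] [r2 [h2 [red2 ->]]].
  exists (r1 + r2), (fun i => h1 i + h2 i); split=> [m i le_q|].
    by rewrite mcoeffD (red1 m i) ?(red2 m i) ?addr0.
  by under [in RHS]eq_bigr do rewrite mulrDl; rewrite big_split /= addrACA.
- move=> m _; have [m' [h [m'_red ->]]] := monom _ m (ltnSn _).
  exists (f@_m *: 'X_[m']), (fun i => f@_m *: h i); split=> [m2 i le_q|].
    rewrite mcoeffZ mcoeffX; case: eqP le_q => [<-|]; last by rewrite mulr0.
    by rewrite leqNgt m'_red.
  rewrite scalerDr scaler_sumr; congr (_ + _).
  by apply: eq_bigr => i _; rewrite scalerAl.
Qed.

(** * Vanishing of integer polynomials modulo a prime *)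

Lemma rmorph_meval_int {R T : comNzRingType} (g : {rmorphism R -> T})
    {n : nat} (f : {mpoly int[n]}) (a : 'I_n -> R) :
  g (map_mpoly intr f).@[a] = (map_mpoly intr f).@[g \o a].
Proof.
rewrite [f]mpolyE !(raddf_sum (map_mpoly _)) !(raddf_sum (meval _)).
rewrite (raddf_sum g).
apply: eq_bigr => m _.
rewrite /= !map_mpolyZ !map_mpolyX !mevalZ !mevalX.
rewrite rmorphM rmorph_prod rmorph_int.
by congr (_ * _); apply: eq_bigr => i _; rewrite rmorphXn.
Qed.

(** If [f] vanishes on [R ^ n], so does the polynomial left after reducing its
    exponents below [q]; that one is then zero over [R], which over the
    integers means divisible by [p], and its quotient by [p] serves as [g]. *)
Lemma int_mpoly_vanishingP {R : comNzRingType}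
    (R_domain : forall x y : R, x * y = 0 -> (x == 0) || (y == 0))
    {p : nat} (pcharR : p \in [pchar R]) {q : nat}
    {v : 'I_q -> R} (v_bij : bijective v) {n : nat} (f : {mpoly int[n]}) :
  (forall a : 'I_n -> R, (map_mpoly intr f).@[a] = 0) <->
  exists (g : {mpoly int[n]}) (h : 'I_n -> {mpoly int[n]}),
    f = g * p%:R + \sum_(i < n) h i * ('X_i ^+ q - 'X_i).
Proof.
have q_gt1 : (1 < q)%N.
  have [w vK wK] := v_bij.
  have ne_w : w 0 != w 1 by rewrite (inj_eq (can_inj wK)) eq_sym oner_neq0.
  have := max_card [set w 0; w 1].
  by rewrite cards2 ne_w card_ord.
pose ev (a : 'I_n -> R) : {rmorphism {mpoly int[n]} -> R} :=
  meval a \o map_mpoly intr.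
have evE a f0 : (map_mpoly intr f0).@[a] = ev a f0 by [].
have ideal_van (h : 'I_n -> {mpoly int[n]}) (a : 'I_n -> R) :
    ev a (\sum_(i < n) h i * ('X_i ^+ q - 'X_i)) = 0.
  rewrite rmorph_sum big1 // => i _.
  have evX : ev a 'X_i = a i by rewrite /= map_mpolyX mevalXU.
  rewrite rmorphM rmorphB rmorphXn evX.
  by rewrite (expf_card_domain R_domain v_bij) subrr mulr0.
split=> [f_van|[g [h ->]] a]; last first.
  rewrite evE (rmorphD (ev a)) ideal_van addr0 rmorphM rmorph_nat.
  by rewrite (pcharf0 pcharR) mulr0.
have [r [h [r_red fE]]] := mpoly_reduce_exponents q_gt1 f.
have r_van a : (map_mpoly intr r).@[a] = 0 :> R.
  by rewrite -[RHS](f_van a) fE !evE (rmorphD (ev a)) ideal_van addr0.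
have r0 : map_mpoly intr r = 0 :> {mpoly R[n]}.
  apply: (mpoly_vanishing_eq0 R_domain (bij_inj v_bij)) => [m i le_q|b];
    last exact: r_van.
  by rewrite mcoeff_map_mpoly (r_red m i).
have p_dvd m : (p %| r@_m)%Z.
  by rewrite (dvdz_pcharf pcharR) -mcoeff_map_mpoly r0 mcoeff0.
exists (\sum_(m <- msupp r) (r@_m %/ p)%Z *: 'X_[m]), h.
rewrite {1}fE; congr (_ + _); rewrite mulr_suml {1}[r]mpolyE.
apply: eq_bigr => m _.
rewrite -{1}(divzK (p_dvd m)) mulr_natr scalerMnl.
by rewrite -(mulr_natr (_ %/ _)%Z) natz.
Qed.

(** Every point of [R ^ n] lifts to [O ^ n], so vanishing modulo the kernel of
    [pi] at all points of [O ^ n] is vanishing on all of [R ^ n]. *)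
Lemma int_mpoly_residually_vanishingP {O R : comNzRingType}
    (pi : {rmorphism O -> R}) (lift : R -> O) (liftK : cancel lift pi)
    (R_domain : forall x y : R, x * y = 0 -> (x == 0) || (y == 0))
    {p : nat} (pcharR : p \in [pchar R]) {q : nat}
    {v : 'I_q -> R} (v_bij : bijective v) {n : nat} (f : {mpoly int[n]}) :
  (forall a : 'I_n -> O, pi (map_mpoly intr f).@[a] = 0) <->
  exists (g : {mpoly int[n]}) (h : 'I_n -> {mpoly int[n]}),
    f = g * p%:R + \sum_(i < n) h i * ('X_i ^+ q - 'X_i).
Proof.
rewrite -(int_mpoly_vanishingP R_domain pcharR v_bij f).
split=> [f_van b | f_van a]; last by rewrite rmorph_meval_int f_van.
have bE : pi \o (lift \o b) =1 b by move=> i; exact: liftK.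
by rewrite -(meval_eq _ bE) -rmorph_meval_int.
Qed.

Theorem mainTheorem15 (K : fieldExtType rat) (n : nat)
    (degK : \dim {:K} = n)
    (sigma : 'I_n -> {rmorphism K -> algC})
    (sigma_enum : enumerates_embeddings sigma)
    (xi : 'I_n -> ringOfIntegers K)
    (xi_basis : is_integral_basis xi)
    (Delta : {mpoly int[n]})
    (Delta_form : is_discriminant_form sigma xi Delta)
    (Gamma : fieldExtType rat)
    (p : nat) (p_prime : prime p)
    (P : prime_idealr (ringOfIntegers Gamma))
    (P_div_p : p%:R \in (P : {pred ringOfIntegers Gamma}))
    (k : nat) (k_degree : is_residual_degree p P k) :
  common_inessential_divisor Delta P <-> contains_divisor_system p k Delta.
Proof.
have [pcharP [e e_basis]] := k_degree.
pose Q := {ideal_quot P}.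
pose pi : {rmorphism ringOfIntegers Gamma -> Q} := \pi_Q%qT.
have mem_piP x : (x \in (P : {pred _})) = (pi x == 0).
  by rewrite -(rmorph0 pi) -Quotient.idealrBE subr0.
pose T := {ffun 'I_k -> 'F_p}.
(* Coordinates in the basis e identify the residue ring with 'F_p ^ k, which
   supplies its enumeration by 'I_(p ^ k). *)
pose comb (c : T) : Q := \sum_(i < k) c i *: e i.
have comb_bij : bijective comb.
  have [w wK] := choice e_basis.
  exists w => [c|y]; last by have [] := wK y.
  by have [_] := wK (comb c); apply.
have card_T : #|T| = (p ^ k)%N by rewrite card_ffun card_Fp // card_ord.
pose v := comb \o enum_val \o cast_ord (esym card_T).
have v_bij : bijective v.
  apply: bij_comp; last exact: (Bijective (cast_ordK _) (cast_ordKV _)).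
  by apply: bij_comp => //; exact: enum_val_bij.
have van_iff := int_mpoly_residually_vanishingP pi repr (@reprK _ Q)
  (@Quotient.rquot_IdomainAxiom _ P) pcharP v_bij Delta.
apply: (iff_trans _ van_iff).
split=> Delta_van a; first by apply/eqP; rewrite -mem_piP.
by rewrite mem_piP Delta_van.
Qed.
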